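(* Let $X$ be a locally compact Hausdorff connected space, let $\mathcal B=C(X)$ if $X$ is compact, and let $\mathcal B$ be one of $C_b(X)$, $C_0(X)$, $C_c(X)$ otherwise. Let $\rho$ be a signed quasi-linear functional on $\mathcal B$. (q1) If $f\in\mathcal B$, $\phi_i\in C(\overline{f(X)})$ for $i=1,\dots,n$ (if $X$ is locally compact but not compact we also require $\phi_i(0)=0$) and $\sum_{i=1}^n\phi_i=\mathrm{id}$, then $\sum_{i=1}^n\rho(\phi_i\circ f)=\rho(f)$. (q2) If $f,g\in\mathcal B$ and $f\cdot g=0$, then $\rho(f+g)=\rho(f)+\rho(g)$. In particular, $\rho(f)=\rho(f^+)-\rho(f^-)$ for any $f\in\mathcal B$. (q3) If $f,g\in\mathcal B$, $0\le g(x)\le f(x)\le c$ for all $x$, and $f=c$ on $\{x:g(x)>0\}$, then $\rho(af+bg)=a\rho(f)+b\rho(g)$ for any $a,b\in\mathbb R$. (q4) Suppose each singly generated subalgebra $S(h)$, $h\in\mathcal B$, contains constants, and $\rho(1)\in\mathbb R$. Suppose $f,g\in\mathcal B$ and $f=c$ (a constant) on the set $\{x:g(x)\ne0\}$. Then $\rho(f+g)=\rho(f)+\rho(g)$. If $\rho$ is a (positive) quasi-linear functional on $\mathcal B$, then: (i) If $f$ and $g$ are in the same singly generated subalgebra $S(h)$, $h\in\mathcal B$, and $f\ge g$, then $\rho(f)\ge\rho(g)$. (ii) If $f,g\in\mathcal B$, $0\le g(x)\le f(x)\le c$ for all $x$, and $f=c$ on $\{x:g(x)>0\}$, then $\rho(f)\ge\rho(g)$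 and $\rho(af+bg)=a\rho(f)+b\rho(g)$ for any $a,b\in\mathbb R$. (iii) If $f\ge g$ and $f,g\in C_c(X)$, then $\rho(f)\ge\rho(g)$. (iv) Suppose each singly generated subalgebra $S(h)$, $h\in\mathcal B$, contains constants. Suppose $f,g\in\mathcal B$ and $f=c$ (a constant) on the set $\{x:g(x)\neq0\}$. Then $\rho(f+g)=\rho(f)+\rho(g)$. If $f\ge g$ then $\rho(f)\ge\rho(g)$. If $f\le g$ then $\rho(f)\le\rho(g)$.
   Context: $C_b(X)$, $C_0(X)$, $C_c(X)$ are the real-valued continuous functions on $X$ that are bounded, vanish at infinity, have compact support, respectively, with the uniform norm. $f^+=\max(f,0)$, $f^-=\max(-f,0)$; $\mathrm{id}$ is the identity function $t\mapsto t$. Singly generated subalgebra: for $f\in\mathcal B$, $S(f)$ is the smallest uniformly closed subalgebra of $\mathcal B$ containing $f$ and, if $X$ is compact, also containing the constant $1$. (If $X$ is compact, $S(f)=\{\phi\circ f:\phi\in C(f(X))\}$; if $X$ is not compact and $f\in C_0(X)$ or $C_c(X)$, $S(f)=\{\phi\circ f:\phi\in C(\overline{f(X)}),\ \phi(0)=0\}$.) Signed quasi-linear functional on $\mathcal B$: a map $\rho:\mathcal B\to\mathbb R$ with $\rho(af)=a\rho(f)$ for $a\in\mathbb R$, $f\in\mathcal B$, and $\rho(f+g)=\rho(f)+\rho(g)$ whenever $f,g\in S(h)$ for some $h\in\mathcal B$. It is a (positive) quasi-linear functional if, in addition, $f\ge0$ implies $\rho(f)\ge0$. *)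

(* Defs.v *)
From HB Require Import structures.
From mathcomp Require Export all_boot all_order all_algebra.
From mathcomp Require Export all_classical all_reals all_analysis.

Set Implicit Arguments.
Unset Strict Implicit.
Unset Printing Implicit Defensive.

Export Order.TTheory GRing.Theory Num.Theory.
Export numFieldNormedType.Exports.

#[export] Set Implicit Arguments.
#[export] Unset Strict Implicit.
#[export] Unset Printing Implicit Defensive.

Global Open Scope classical_set_scope.
Global Open Scope ring_scope.

Section FunctionSpaces.
Variables (X : topologicalType) (R : realType).

Definition C_all : set (X -> R) := [set f | continuous f].

Definition C_b : set (X -> R) := [set f | continuous f /\ bounded_fun f].

Definition C_0 : set (X -> R) :=
  [set f | continuous f /\
           forall e : R, 0 < e -> compact [set x | e <= `|f x|]].

Definition C_c : set (X -> R) :=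
  [set f | continuous f /\ compact (closure [set x | f x != 0])].

Definition admissible_class (B : set (X -> R)) : Prop :=
  (compact [set: X] -> B = C_all) /\
  (~ compact [set: X] -> [\/ B = C_b, B = C_0 | B = C_c]).

(* Subalgebras need not contain the constant function 1. *)
Definition subalgebra_of (B A : set (X -> R)) : Prop :=
  [/\ A `<=` B,
      A 0,
      forall (a : R) (f : X -> R), A f -> A (a *: f),
      forall f g : X -> R, A f -> A g -> A (f + g)
    & forall f g : X -> R, A f -> A g -> A (f * g)].

(* Closedness is relative to B, whose uniform norm induces the topology of
   uniform convergence: C_c itself is in general not closed among all
   functions. *)
Definition uniformly_closed_in (B A : set (X -> R)) : Prop :=
  B `&` closure (A : set {uniform X -> R}) `<=` A.

(* The smallest such subalgebra, as the intersection of all of them; B is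
   itself one whenever B is an admissible class and f is in B. *)
Definition singly_generated (B : set (X -> R)) (f : X -> R) : set (X -> R) :=
  [set u | forall A : set (X -> R),
     subalgebra_of B A -> uniformly_closed_in B A -> A f ->
     (compact [set: X] -> A (cst 1)) -> A u].

(* A functional on B is represented by a map on all functions X -> R whose
   values outside B are irrelevant. *)
Definition signed_quasi_linear (B : set (X -> R)) (rho : (X -> R) -> R) : Prop :=
  (forall (a : R) (f : X -> R), B f -> rho (a *: f) = a * rho f) /\
  (forall h f g : X -> R, B h ->
     singly_generated B h f -> singly_generated B h g ->
     rho (f + g) = rho f + rho g).

Definition quasi_linear (B : set (X -> R)) (rho : (X -> R) -> R) : Prop :=
  signed_quasi_linear B rho /\
  (forall f : X -> R, B f -> (forall x, 0 <= f x) -> 0 <= rho f).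

Definition all_contain_constants (B : set (X -> R)) : Prop :=
  forall h : X -> R, B h -> forall k : R, singly_generated B h (cst k).

End FunctionSpaces.

(* Main.v *)
(* Polynomial approximation (Bernstein, with the weights generated by the
   recursion E_{n+1} g = x E_n (g o S) + (1 - x) E_n g) shows that phi o f lies
   in S(f) for every continuous phi, with phi 0 = 0 when X is not compact.
   Additivity of rho for f and g is then obtained by exhibiting both as
   functions of one h: f - g for disjoint nonnegative functions, f + g for (q3).
   Monotonicity, for all f >= g >= 0 in B, comes from cutting the range into
   slices of height d: (q3) compares the (k+1)-st slice of g with the k-th slice
   of f, and the lowest slice of g is controlled by
   min(t, e^2) <= e sqrt t, so rho g <= rho f + e rho (sqrt g). *)
Require Import Defs.
From mathcomp Require Import ring lra.

(** * Bernstein polynomials and Weierstrass approximation *)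

(** The value at [x] is the mean of [g] under the binomial law with parameters [n] and [x]. The
    recursion conditions on one trial, so moments follow by induction without binomial
    coefficients. *)
Fixpoint bernstein (R : comNzRingType) (n : nat) (g : nat -> R) : {poly R} :=
  if n is m.+1 then
    'X * bernstein m (fun k => g k.+1) + (1 - 'X) * bernstein m g
  else (g 0%N)%:P.

Lemma horner_bernsteinS (R : comNzRingType) n (g : nat -> R) x :
  (bernstein n.+1 g).[x] =
  x * (bernstein n (fun k => g k.+1)).[x] + (1 - x) * (bernstein n g).[x].
Proof. by rewrite /= !hornerE. Qed.

Lemma ler_bernstein (R : realDomainType) n (g h : nat -> R) x :
  0 <= x <= 1 -> (forall k, (k <= n)%N -> g k <= h k) ->
  (bernstein n g).[x] <= (bernstein n h).[x].
Proof.
move=> /andP[x0 x1]; elim: n g h => [|n IH] g h gh.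
  by rewrite /= !hornerE gh.
rewrite !horner_bernsteinS lerD // ler_wpM2l ?subr_ge0 //; apply: IH => k kn.
  exact: gh.
by apply: gh; rewrite (leq_trans kn).
Qed.

(** Second moment of the binomial law about [a]: squared bias plus the variance [n x (1 - x)]. The
    affine form in [b] and [c] is that of the majorant used for Weierstrass. *)
Lemma bernstein_sqr (R : comNzRingType) n (a b c x : R) :
  (bernstein n (fun k => b + c * (k%:R - a) ^+ 2)).[x] =
  b + c * ((n%:R * x - a) ^+ 2 + n%:R * x * (1 - x)).
Proof.
elim: n a => [|n IH] a; first by rewrite /= !hornerE; ring.
rewrite horner_bernsteinS IH.
(* Shifting [k] by one is absorbed by replacing [a] with [a - 1], hence the induction over all
   [a]. *)
rewrite (_ : (fun k => _) = (fun k => b + c * (k%:R - (a - 1)) ^+ 2)).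
  by rewrite IH; ring.
by apply/funext => k; rewrite -natr1; congr (_ + _ * _ ^+ 2); ring.
Qed.

(** Compactness is used as a near covering along [d] tending to 0 from the right: half of the local
    radius covers the nearby points, the other half bounds the tolerance. The point [y] may leave
    [K]. *)
Lemma compact_uniform_continuity (R : realType) (K : set R) (F : R -> R) (e : R) :
  compact K -> continuous F -> 0 < e ->
  exists2 d : R, 0 < d &
    forall x y, K x -> `|x - y| < d -> `|F x - F y| < e.
Proof.
move=> /compact_near_coveringP cK cF e0.
have := cK _ (0^'+)
  (fun d x => forall y, `|x - y| < d -> `|F x - F y| < e) _.
case=> [x Kx|d /= d0 Hd].
  have /cvgrPdist_lt/(_ (e / 2)) := cF x; rewrite divr_gt0// => /(_ isT).
  move=> /nbhs_ballP[d /= d0 Hd].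
  exists (ball x (d / 2), [set t | t < d / 2]) => /=.
    split; first exact: nbhsx_ballx _ _ (divr_gt0 d0 _).
    exact: nbhs_right_lt (divr_gt0 d0 _).
  move=> [z t] /= [xz td] y zy.
  have Fz : `|F x - F z| < e / 2.
    apply: Hd; rewrite /ball /= in xz *; apply: lt_trans xz _.
    by rewrite ltr_pdivrMr// ltr_pMr// ltr1n.
  have Fy : `|F x - F y| < e / 2.
    apply: Hd; rewrite /ball /= in xz *; rewrite -(subrKA z).
    rewrite (le_lt_trans (ler_normD _ _))// [d]splitr ltrD//.
    exact: lt_trans zy td.
  rewrite -(subrKA (F x)) (le_lt_trans (ler_normD _ _))// [e]splitr ltrD//.
  by rewrite distrC.
exists (d / 2); first by rewrite divr_gt0.
move=> x y Kx xy; apply: (Hd (d / 2)) => //=.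
- by rewrite sub0r normrN gtr0_norm ?divr_gt0// ltr_pdivrMr// ltr_pMr// ltr1n.
- by rewrite divr_gt0.
Qed.

Lemma compact_image_bounded (R : realType) (X : topologicalType) (K : set X)
    (f : X -> R) :
  compact K -> continuous f -> exists M : R, forall x, K x -> `|f x| <= M.
Proof.
move=> cK cf.
have : compact (f @` K).
  by apply: continuous_compact => //; exact: continuous_subspaceT.
move=> /compact_bounded[M [_ Mf]]; exists (M + 1) => x Kx.
by apply: (Mf (M + 1)); rewrite ?ltrDl//; exists x.
Qed.

Lemma closed_norm_ge (R : realType) (X : topologicalType) (f : X -> R) (e : R) :
  continuous f -> closed [set x | e <= `|f x|].
Proof.
move=> cf.
apply: (@closed_comp _ _ (fun x => `|f x|) [set t | e <= t]); last exact: closed_ge.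
by move=> x _; apply: continuous_comp; [exact: cf|exact: norm_continuous].
Qed.

(** The values at the nodes are squeezed between two quadratics in [k]: uniform continuity handles
    nodes near [x], and the quadratic term exceeds [2 * M] at the others. Monotonicity and the
    second moment then bound the polynomial. *)
Lemma weierstrass01 (R : realType) (F : R -> R) (e : R) :
  continuous F -> 0 < e ->
  exists p : {poly R}, forall x : R, 0 <= x <= 1 -> `|F x - p.[x]| < e.
Proof.
move=> cF e0.
have c01 : compact [set` `[0 : R, 1]] by exact: segment_compact.
have [d d0 Fd] := compact_uniform_continuity c01 cF (divr_gt0 e0 (ltr0n R 2)).
have [M0 M0_F] := compact_image_bounded c01 cF.
pose M : R := `|M0| + 1.
have M_gt0 : (0 : R) < M by rewrite ltr_wpDl.
have MF (x : R) : 0 <= x <= 1 -> `|F x| <= M.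
  move=> x01; have := M0_F x; rewrite /= in_itv/= => /(_ x01) /le_trans.
  by apply; rewrite /M; have := ler_norm M0; lra.
(* This size makes [c * n], which equals [2 * M / (d ^+ 2 * n)], smaller than [e / 2]. *)
pose n := (Num.bound (4 * M / (e * d ^+ 2))).+1.
have n0 : 0 < n%:R :> R by rewrite ltr0n.
have nM : 4 * M / (e * d ^+ 2) < n%:R.
  rewrite (lt_le_trans (archi_boundP _))// ?ler_nat//.
  by rewrite divr_ge0 ?mulr_ge0 ?exprn_ge0 ?ltW.
exists (bernstein n (fun k => F (k%:R / n%:R))) => x x01.
set p := _.[x].
(* Chosen so that the quadratic term reaches [2 * M] exactly when the node is at distance [d] from
   [x]. *)
pose c : R := 2 * M / (d * n%:R) ^+ 2.
have dn0 : 0 < d * n%:R by rewrite mulr_gt0.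
have c0 : 0 <= c by rewrite /c divr_ge0 ?mulr_ge0 ?sqr_ge0 ?ltW.
have close k : (k <= n)%N ->
    `|F x - F (k%:R / n%:R)| <= e / 2 + c * (k%:R - n%:R * x) ^+ 2.
  move=> kn; have [xk|xk] := ltP (`|x - k%:R / n%:R|) d.
    rewrite ltW// (lt_le_trans (Fd _ _ _ xk))//= ?in_itv//.
    by rewrite lerDl mulr_ge0 ?sqr_ge0.
  have k01 : 0 <= (k%:R / n%:R : R) <= 1.
    by rewrite divr_ge0// ler_pdivrMr// mul1r ler_nat.
  rewrite (le_trans (ler_normB _ _))//.
  apply: (@le_trans _ _ (2 * M)); first by have := MF _ x01; have := MF _ k01; lra.
  apply: (@le_trans _ _ (c * (k%:R - n%:R * x) ^+ 2)); last by lra.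
  rewrite /c mulrAC -mulrA ler_peMr ?mulr_ge0 ?(ltW M_gt0)//.
  rewrite ler_pdivlMr ?exprn_gt0// mul1r -[leRHS]real_normK ?num_real//.
  rewrite lerXn2r ?nnegrE ?normr_ge0 ?(ltW dn0)//.
  rewrite (_ : _ - _ = - (x - k%:R / n%:R) * n%:R); last by field; lra.
  by rewrite normrM normrN (gtr0_norm n0) ler_pM2r.
have small : c * (n%:R * x * (1 - x)) < e / 2.
  have x14 : x * (1 - x) <= 1 by nra.
  rewrite -mulrA.
  apply: (@le_lt_trans _ _ (c * n%:R)); first by rewrite ler_wpM2l// ler_piMr// ltW.
  rewrite (_ : c * _ = (4 * M / (e * d ^+ 2)) * (e / (2 * n%:R))).
    rewrite (lt_le_trans (y := n%:R * (e / (2 * n%:R))))//.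
      by rewrite ltr_pM2r// divr_gt0// mulr_gt0.
    by rewrite le_eqVlt; apply/orP; left; apply/eqP; field; rewrite !gt_eqF.
  by rewrite /c; field; rewrite !gt_eqF.
have up : p <= F x + e / 2 + c * (n%:R * x * (1 - x)).
  have := bernstein_sqr n (n%:R * x) (F x + e / 2) c x.
  rewrite subrr expr0n add0r => <-; apply: ler_bernstein => // k kn.
  by have := close k kn; rewrite ler_norml; lra.
have down : F x - e / 2 - c * (n%:R * x * (1 - x)) <= p.
  have := bernstein_sqr n (n%:R * x) (F x - e / 2) (- c) x.
  rewrite subrr expr0n add0r mulNr => <-; apply: ler_bernstein => // k kn.
  by have := close k kn; rewrite ler_norml; lra.
by rewrite ltr_norml; apply/andP; split; lra.
Qed.

Lemma weierstrass (R : realType) (F : R -> R) (M e : R) :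
  continuous F -> 0 < M -> 0 < e ->
  exists p : {poly R}, forall x : R, `|x| <= M -> `|F x - p.[x]| < e.
Proof.
move=> cF M0 e0.
have cG : continuous (fun s => F (2 * M * s - M)).
  move=> s; apply: continuous_comp; last exact: cF.
  by apply: cvgB; [apply: cvgMr|exact: cvg_cst].
have [p Fp] := weierstrass01 cG e0.
exists (p \Po ((2 * M)^-1 *: 'X + 2^-1%:P)) => x xM.
have := Fp ((2 * M)^-1 * x + 2^-1).
rewrite horner_comp !hornerE (_ : 2 * M * _ - M = x); last by field; lra.
apply; move: xM; rewrite ler_norml => /andP[xM Mx].
rewrite (_ : (2 * M)^-1 * x + 2^-1 = (x + M) / (2 * M)); last by field; lra.
by rewrite divr_ge0 ?ler_pdivrMr ?mulr_gt0//; lra.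
Qed.

(** * Closure properties of the admissible classes and of singly generated subalgebras *)

Section AdmissibleClass.
Variables (R : realType) (X : topologicalType) (B : set (X -> R)).
Hypothesis admB : admissible_class B.

Lemma admissible_cases :
  (compact [set: X] /\ B = @C_all X R) \/
  (~ compact [set: X] /\ [\/ B = @C_b X R, B = @C_0 X R | B = @C_c X R]).
Proof.
have [cX|cX] := pselect (compact [set: X]); [left|right]; split => //.
  exact: (admB.1 cX).
exact: (admB.2 cX).
Qed.

Lemma admissible_continuous f : B f -> continuous f.
Proof. by case: admissible_cases => -[_]; [move=> ->|case=> -> []]. Qed.

Lemma admissible_bounded f :
  B f -> exists2 M : R, 0 < M & forall x, `|f x| <= M.
Proof.
move=> Bf; suff [M Mf] : exists M : R, forall x, `|f x| <= M.
  exists (`|M| + 1); first by rewrite ltr_wpDl.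
  by move=> x; rewrite (le_trans (Mf x))// ler_wpDr// ler_norm.
have cf := admissible_continuous Bf.
case: admissible_cases Bf => -[cX].
  by move=> _ _; have [M Mf] := compact_image_bounded cX cf; exists M => x; exact: Mf.
case=> -> [_].
- by case=> M [_ Mf]; exists (M + 1) => x; apply: Mf; rewrite ?ltrDl.
- move=> /(_ 1 ltr01) /compact_image_bounded/(_ cf)[M Mf].
  exists (Num.max M 1) => x; rewrite le_max.
  by have [/Mf ->//|/ltW ->] := leP 1 `|f x|; rewrite orbT.
- move=> /compact_image_bounded/(_ cf)[M Mf].
  exists (Num.max M 0) => x; rewrite le_max.
  have [->|fx0] := eqVneq (f x) 0; first by rewrite normr0 lexx orbT.
  by rewrite Mf//; exact: subset_closure.
Qed.

(** One membership test for all four classes: level sets of [h] lie in unions of level sets of [f]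
    and [g], which transfers both vanishing at infinity and compact support. *)
Lemma admissible_dominated f g h : B f -> B g -> continuous h ->
  (exists M : R, forall x, `|h x| <= M) ->
  (~ compact [set: X] -> forall e : R, 0 < e -> exists2 d : R, 0 < d &
    forall x, e <= `|h x| -> d <= `|f x| \/ d <= `|g x|) ->
  B h.
Proof.
move=> Bf Bg ch [M Mh] dom.
case: admissible_cases Bf Bg => -[cX]; first by move=> ->.
have {}dom := dom cX; case=> -> -[cf Bf] [cg Bg]; split => //.
- by exists M; split; [exact: num_real|move=> N MN x _ /=; rewrite (le_trans (Mh x))// ltW].
- move=> e e0; have [d d0 efg] := dom e e0.
  apply: (@subclosed_compact _ _ ([set x | d <= `|f x|] `|` [set x | d <= `|g x|])).
  + exact: closed_norm_ge.
  + by apply: compactU; [exact: Bf|exact: Bg].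
  + by move=> x /= /efg.
- apply: subclosed_compact (compactU Bf Bg) _; first exact: closed_closure.
  rewrite -closureU; apply: closureS => x /= hx.
  (* Taking the level to be the value at [x] itself shows that [f] or [g] is nonzero at [x]. *)
  have [|d d0 /(_ x (lexx _))] := dom `|h x|; first by rewrite normr_gt0.
  rewrite -!normr_gt0; case=> dx; [left|right]; exact: lt_le_trans dx.
Qed.

(** Such [phi] live on the whole line, so one function can be composed with any member of [B];
    vanishing at 0 preserves decay and compact support. *)
Definition composable (phi : R -> R) :=
  continuous phi /\ (~ compact [set: X] -> phi 0 = 0).

Lemma admissible_comp f phi : B f -> composable phi -> B (phi \o f).
Proof.
move=> Bf [cphi phi0]; have cf := admissible_continuous Bf.
have [M M0 Mf] := admissible_bounded Bf.
apply: (admissible_dominated Bf Bf).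
- by move=> x; apply: continuous_comp; [exact: cf|exact: cphi].
- have [N Nphi] := compact_image_bounded (segment_compact (a := - M) (b := M)) cphi.
  by exists N => x; apply: Nphi; rewrite /= in_itv/= -ler_norml.
- move=> cX e e0.
  have /cvgrPdist_lt/(_ e e0)/nbhs_ballP[d /= d0 dphi] := cphi 0.
  exists d => // x; left; rewrite leNgt; apply/negP => fxd.
  have := dphi (f x); rewrite /ball/= sub0r normrN => /(_ fxd).
  by rewrite phi0// sub0r normrN ltNge => /negP.
Qed.

Lemma composable_scale a : composable ( *%R a).
Proof. by split=> [x|_]; [exact: mulrl_continuous|rewrite mulr0]. Qed.

Lemma composableD phi psi : composable phi -> composable psi ->
  composable (fun t => phi t + psi t).
Proof.
move=> [cphi phi0] [cpsi psi0]; split=> [t|cX].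
  by apply: cvgD; [exact: cphi|exact: cpsi].
by rewrite phi0// psi0// addr0.
Qed.

Lemma admissible_subalgebra f0 : B f0 -> subalgebra_of B B.
Proof.
have BZ (a : R) (f : X -> R) : B f -> B (a *: f).
  by move=> Bf; exact: admissible_comp Bf (composable_scale a).
move=> Bf0; split => //.
- rewrite (_ : 0 = 0 *: f0); first exact: BZ.
  by apply/funext => x /=; rewrite scale0r.
- move=> f g Bf Bg; apply: (admissible_dominated Bf Bg).
  + by move=> x; apply: cvgD; exact: admissible_continuous.
  + have [M _ Mf] := admissible_bounded Bf; have [N _ Ng] := admissible_bounded Bg.
    by exists (M + N) => x; rewrite (le_trans (ler_normD _ _))// lerD.
  + move=> _ e e0; exists (e / 2) => [|x]; first exact: divr_gt0.
    move=> efg; have [fx|fx] := leP (e / 2) `|f x|; [by left|right].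
    rewrite leNgt; apply/negP => gx; move: efg; rewrite leNgt => /negP; apply.
    by rewrite (le_lt_trans (ler_normD _ _))// [e]splitr ltrD.
- move=> f g Bf Bg.
  have [M _ Mf] := admissible_bounded Bf; have [N N0 Ng] := admissible_bounded Bg.
  apply: (admissible_dominated Bf Bg).
  + by move=> x; apply: cvgM; exact: admissible_continuous.
  + by exists (M * N) => x; rewrite normrM ler_pM.
  + move=> _ e e0; exists (e / N) => [|x]; first exact: divr_gt0.
    rewrite normrM => /le_trans efg; left; rewrite ler_pdivrMr// efg//.
    by rewrite ler_wpM2l.
Qed.

Lemma singly_generated_subalgebra f : B f ->
  subalgebra_of B (singly_generated B f).
Proof.
move=> Bf; have sB := admissible_subalgebra Bf; split.
(* [B] is itself one of the subalgebras being intersected, whence the inclusion in [B]. *)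
- move=> u; apply => //; first by move=> v [].
  by move=> cX; rewrite (admB.1 cX) => x; exact: cvg_cst.
- by move=> A [].
- by move=> a u Su A sA cA Af A1; have [_ _ + _ _] := sA; apply; exact: Su.
- by move=> u v Su Sv A sA cA Af A1; have [_ _ _ + _] := sA; apply; [exact: Su|exact: Sv].
- by move=> u v Su Sv A sA cA Af A1; have [_ _ _ _] := sA; apply; [exact: Su|exact: Sv].
Qed.

(** Multiples of ['X] can be evaluated at [f] without a unit; the constant term is either zero or
    carried by the unit of [A]. *)
Lemma subalgebra_poly A f (p : {poly R}) : subalgebra_of B A -> A f ->
  (p.[0] = 0 \/ A (cst 1)) -> A (fun x => p.[f x]).
Proof.
move=> [_ A0 AZ AD AM] Af.
have Xq (q : {poly R}) : A (fun x => q.[f x] * f x).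
  elim/poly_ind: q => [|q c IH].
    by rewrite (_ : (fun _ => _) = 0)//; apply/funext => x; rewrite horner0 mul0r.
  have := AD _ _ (AM _ _ IH Af) (AZ c _ Af); congr A.
  by apply/funext => x; rewrite hornerMXaddC [RHS]mulrDl.
elim/poly_ind: p => [_|q c _].
  by have := A0; congr A; apply/funext => x; rewrite horner0.
rewrite hornerMXaddC mulr0 add0r => -[c0|A1].
  by have := Xq q; congr A; apply/funext => x; rewrite hornerMXaddC c0 addr0.
have := AD _ _ (Xq q) (AZ c _ A1); congr A.
by apply/funext => x; rewrite hornerMXaddC; congr (_ + _); exact: mulr1.
Qed.

(** Every competing subalgebra contains the polynomials in [f] that approximate [phi \o f]
    uniformly, and it is closed in [B]. *)
Lemma singly_generated_comp f phi : B f -> composable phi ->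
  singly_generated B f (phi \o f).
Proof.
move=> Bf phiP A sA cA Af A1; apply: cA; split; first exact: admissible_comp.
have [cphi phi0] := phiP; have [M M0 Mf] := admissible_bounded Bf.
move=> U /uniform_nbhs[E [entE EU]].
have [e /= e0 eE] : exists2 e : R, 0 < e & forall s t, `|s - t| < e -> E (s, t).
  move: entE; rewrite -entourage_ballE => -[e /= e0 eE]; exists e => // s t st.
  by apply: eE.
have [p Fp] := weierstrass cphi M0 (divr_gt0 e0 (ltr0n R 2)).
have [q [q0 Fq]] : exists q : {poly R}, (q.[0] = 0 \/ compact [set: X]) /\
    forall x : R, `|x| <= M -> `|phi x - q.[x]| < e.
  have [cX|cX] := pselect (compact [set: X]).
    exists p; split=> [|x /Fp /lt_trans]; first by right.
    by apply; rewrite ltr_pdivrMr// ltr_pMr// ltr1n.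
  (* Without a unit the constant term must go. It is within [e / 2] of [phi 0 = 0], so removing it
     costs the second half of [e]. *)
  exists (p - p.[0]%:P); split=> [|x /Fp phip].
    by left; rewrite hornerD hornerN hornerC subrr.
  have p0 : `|p.[0]| < e / 2.
    by have := Fp 0; rewrite normr0 phi0// sub0r normrN; apply; exact: ltW.
  rewrite hornerD hornerN hornerC opprB addrCA [e]splitr.
  by rewrite (le_lt_trans (ler_normD _ _))// ltrD.
exists (fun x => q.[f x]); split; last by apply: EU => x _; apply: eE; exact: Fq.
by apply: subalgebra_poly => //; case: q0 => [|cX]; [left|right; exact: A1].
Qed.

End AdmissibleClass.

(** * Tietze extension, then additivity of signed quasi-linear functionals *)

Lemma compact_extension (R : realType) (K : set R) (phi : R -> R) :
  compact K -> {within K, continuous phi} ->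
  exists2 psi : R -> R, continuous psi & forall t, K t -> psi t = phi t.
Proof.
move=> cK cphi.
have [M0 [_ M0phi]] := compact_bounded (continuous_compact cphi cK).
pose M : R := `|M0| + 1.
have M_gt0 : (0 : R) < M by rewrite ltr_wpDl.
have Mphi t : K t -> `|phi t| <= M.
  by move=> Kt; apply: (M0phi M); [rewrite /M; have := ler_norm M0; lra|exists t].
have clK := compact_closed (@Rhausdorff R) cK.
have [psi [psiE cpsi _]] :=
  continuous_bounded_extension (@pseudometric_normal R R) clK M_gt0 cphi Mphi.
by exists psi => // t Kt; rewrite psiE// inE.
Qed.

Section SignedQuasiLinear.
Variables (R : realType) (X : topologicalType) (B : set (X -> R)).
Variable rho : (X -> R) -> R.
Hypothesis admB : admissible_class B.
Hypothesis rhoB : signed_quasi_linear B rho.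
Local Notation composable := (composable X).
Implicit Types (f g : X -> R) (phi psi : R -> R).

Lemma range_closure_compact f : B f -> compact (closure (range f)).
Proof.
move=> Bf; have [M _ Mf] := admissible_bounded admB Bf.
apply: (@subclosed_compact _ _ `[- M, M]%classic).
- exact: closed_closure.
- exact: segment_compact.
- rewrite closureE => t; apply; split; first exact: itv_closed.
  by move=> _ [x _ <-] /=; rewrite in_itv/= -ler_norml.
Qed.

(** Tietze gives a continuous extension; its value at 0 has to be corrected when 0 lies outside the
    closed range and [X] is not compact. *)
Lemma composable_extension f phi : B f ->
  {within closure (range f), continuous phi} ->
  (~ compact [set: X] -> closure (range f) 0 -> phi 0 = 0) ->
  exists2 psi, composable psi & forall t, closure (range f) t -> psi t = phi t.
Proof.
move=> Bf cphi phi0.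
have [psi cpsi psiE] := compact_extension (range_closure_compact Bf) cphi.
have [good|] := pselect (compact [set: X] \/ closure (range f) 0).
  exists psi => //; split => // cX; case: good => // f0.
  by rewrite psiE// phi0.
move=> /not_orP[cX f0].
have /nbhs_ballP[d /= d0 df] : nbhs (0 : R) (~` closure (range f)).
  by apply: open_nbhs_nbhs; split => //; exact/closed_openC/closed_closure.
(* The factor vanishes at 0 and equals 1 on the closed range, which stays at distance at least [d]
   from 0. *)
exists (fun t => psi t * Num.min (`|t| / d) 1).
  split=> [t|_]; last by rewrite normr0 mul0r min_l// mulr0.
  apply: cvgM; first exact: cpsi.
  apply: (@continuous_min R R (fun t => `|t| / d) (fun=> 1)); last exact: cvg_cst.
  by apply: cvgMl; exact: norm_continuous.
move=> t ft; rewrite min_r ?mulr1 ?psiE//.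
rewrite ler_pdivlMr// mul1r leNgt; apply/negP => td.
by apply: (df t) ft; rewrite /ball/= sub0r normrN.
Qed.

Lemma rhoZ a f : B f -> rho (a *: f) = a * rho f.
Proof. exact: rhoB.1. Qed.

Lemma rhoN f : B f -> rho (- f) = - rho f.
Proof.
move=> Bf; rewrite -[RHS]mulN1r -rhoZ//; congr rho; apply/funext => x.
by rewrite /= scaleN1r.
Qed.

Lemma rho_compD f phi psi : B f -> composable phi -> composable psi ->
  rho (fun x => phi (f x) + psi (f x)) = rho (phi \o f) + rho (psi \o f).
Proof.
move=> Bf phiP psiP.
by apply: (rhoB.2 f (phi \o f) (psi \o f) Bf); exact: singly_generated_comp.
Qed.

Lemma rho_comp_sum f (I : Type) (r : seq I) (phi : I -> R -> R) : B f ->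
  (forall i, composable (phi i)) ->
  rho (fun x => \sum_(i <- r) phi i (f x)) = \sum_(i <- r) rho (phi i \o f).
Proof.
move=> Bf phiP.
have sumP s : composable (fun t => \sum_(i <- s) phi i t).
  elim: s => [|i s IH].
    rewrite (_ : (fun _ => _) = fun=> 0).
      by split=> // t; exact: cvg_cst.
    by apply/funext => t; rewrite big_nil.
  rewrite (_ : (fun _ => _) = fun t => phi i t + \sum_(j <- s) phi j t).
    exact: composableD.
  by apply/funext => t; rewrite big_cons.
elim: r => [|i r IH].
  rewrite big_nil -[RHS](mul0r (rho f)) -rhoZ//; congr rho; apply/funext => x.
  by rewrite big_nil [RHS]scale0r.
rewrite big_cons -IH -(rho_compD Bf (phiP i) (sumP r)); congr rho.
by apply/funext => x; rewrite big_cons.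
Qed.

(** Composable extensions leave the compositions with [f] unchanged, so the claim becomes finite
    additivity on the subalgebra generated by [f]. *)
Lemma rho_partition f (n : nat) (phi : 'I_n -> R -> R) : B f ->
  (forall i, {within closure (range f), continuous (phi i)}) ->
  (~ compact [set: X] -> forall i, closure (range f) 0 -> phi i 0 = 0) ->
  (forall t, closure (range f) t -> \sum_(i < n) phi i t = t) ->
  \sum_(i < n) rho (phi i \o f) = rho f.
Proof.
move=> Bf cphi phi0 phi1.
have ext i : {psi : R -> R | composable psi /\
    forall t, closure (range f) t -> psi t = phi i t}.
  apply: cid; have [|psi] := @composable_extension f (phi i) Bf (cphi i).
    by move=> cX; exact: phi0.
  by exists psi.
pose psi i := projT1 (ext i).
have psiP i : composable (psi i) by have [] := projT2 (ext i).
have fx x : closure (range f) (f x) by apply: subset_closure; exists x.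
have psiE i x : psi i (f x) = phi i (f x) by have [_] := projT2 (ext i); apply.
transitivity (\sum_(i < n) rho (psi i \o f)).
  by apply: eq_bigr => i _; congr rho; apply/funext => x; rewrite /= psiE.
rewrite -rho_comp_sum//; congr rho; apply/funext => x.
by rewrite -[RHS]phi1//; apply: eq_bigr => i _; rewrite psiE.
Qed.

Lemma composable_id : composable (@id R).
Proof. by split=> // t; exact: cvg_id. Qed.

Lemma composable_min (c : R) : (~ compact [set: X] -> 0 <= c) ->
  composable (fun t => Num.min t c).
Proof.
move=> c0; split=> [t|cX]; last by rewrite min_l// c0.
by apply: (@continuous_min R R id (fun=> c)); [exact: cvg_id|exact: cvg_cst].
Qed.

Lemma composable_excess (c : R) : (~ compact [set: X] -> 0 <= c) ->
  composable (fun t => Num.max (t - c) 0).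
Proof.
move=> c0; split=> [t|cX]; last by rewrite max_r// sub0r oppr_le0 c0.
apply: (@continuous_max R R (fun t => t - c) (fun=> 0)); last exact: cvg_cst.
by apply: cvgB; [exact: cvg_id|exact: cvg_cst].
Qed.

Lemma composable_comp phi psi : composable phi -> composable psi ->
  composable (psi \o phi).
Proof.
move=> [cphi phi0] [cpsi psi0]; split=> [t|cX].
  by apply: continuous_comp; [exact: cphi|exact: cpsi].
by rewrite /= phi0// psi0.
Qed.

Lemma composable_pos : composable (fun t : R => Num.max t 0).
Proof.
have := composable_excess (fun=> lexx 0).
by congr (composable _); apply/funext => t; rewrite subr0.
Qed.

Lemma composable_neg : composable (fun t : R => Num.max (- t) 0).
Proof.
have := composable_comp (composable_scale X (-1)) composable_pos.
by congr (composable _); apply/funext => t; rewrite /= mulN1r.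
Qed.

Lemma admissible_funrpos f : B f -> B (f ^\+).
Proof. by move=> Bf; exact: (admissible_comp admB Bf composable_pos). Qed.

Lemma admissible_funrneg f : B f -> B (f ^\-).
Proof. by move=> Bf; exact: (admissible_comp admB Bf composable_neg). Qed.

Lemma admissibleD f g : B f -> B g -> B (f + g).
Proof. by move=> Bf; have [_ _ _ + _] := admissible_subalgebra admB Bf; apply. Qed.

Lemma admissibleN f : B f -> B (- f).
Proof.
move=> Bf; have [_ _ /(_ (-1) _ Bf) + _ _] := admissible_subalgebra admB Bf.
by congr B; apply/funext => x; rewrite /= scaleN1r.
Qed.

Lemma rho_funrposneg f : B f -> rho f = rho (f ^\+) - rho (f ^\-).
Proof.
move=> Bf; rewrite -(rhoN (admissible_funrneg Bf)).
have negP := composable_comp composable_neg (composable_scale X (-1)).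
transitivity (rho ((fun t => Num.max t 0) \o f) +
    rho ((fun t => -1 * Num.max (- t) 0) \o f)); last first.
  by congr (_ + rho _); apply/funext => x; rewrite /= mulN1r.
rewrite -(rho_compD Bf composable_pos negP); congr rho; apply/funext => x.
by case: (leP (f x) 0) => fx /=; rewrite mulN1r; [rewrite max_l|rewrite max_r]; lra.
Qed.

(** Here [f] and [g] are the positive and negative parts of [f - g]. *)
Lemma rho_disjoint_ge0 f g : B f -> B g ->
  (forall x, 0 <= f x) -> (forall x, 0 <= g x) -> (forall x, f x = 0 \/ g x = 0) ->
  rho (f + g) = rho f + rho g.
Proof.
move=> Bf Bg f0 g0 fg.
have fE : f = (fun t => Num.max t 0) \o (f - g).
  apply/funext => x /=; rewrite -[(f - g) x]/(f x - g x).
  have fx := f0 x; have gx := g0 x.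
  by case: (fg x) => e; rewrite e in fx gx *; case: leP; lra.
have gE : g = (fun t => Num.max (- t) 0) \o (f - g).
  apply/funext => x /=; rewrite -[(f - g) x]/(f x - g x).
  have fx := f0 x; have gx := g0 x.
  by case: (fg x) => e; rewrite e in fx gx *; case: leP; lra.
have Bfg := admissibleD Bf (admissibleN Bg).
rewrite [in RHS]fE [X in _ = _ + rho X]gE -(rho_compD Bfg composable_pos composable_neg).
congr rho; apply/funext => x.
by congr (_ + _); [exact: (congr1 (@^~ x) fE)|exact: (congr1 (@^~ x) gE)].
Qed.

(** For disjoint functions, taking positive and negative parts commutes with the sum, which reduces
    the claim to the nonnegative case. *)
Lemma rho_disjoint f g : B f -> B g -> (forall x, f x = 0 \/ g x = 0) ->
  rho (f + g) = rho f + rho g.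
Proof.
move=> Bf Bg fg.
have posD : (f + g) ^\+ = f ^\+ + g ^\+.
  apply/funext => x; rewrite -[RHS]/(f^\+ x + g^\+ x) /funrpos -[(f + g) x]/(f x + g x).
  by case: (fg x) => ->; rewrite maxxx ?addr0 ?add0r.
have negD : (f + g) ^\- = f ^\- + g ^\-.
  apply/funext => x; rewrite -[RHS]/(f^\- x + g^\- x) /funrneg -[(f + g) x]/(f x + g x).
  by case: (fg x) => ->; rewrite oppr0 maxxx ?addr0 ?add0r.
rewrite (rho_funrposneg (admissibleD Bf Bg)) posD negD.
rewrite !rho_disjoint_ge0; first by rewrite (rho_funrposneg Bf) (rho_funrposneg Bg); lra.
all: try exact: funrpos_ge0; try exact: funrneg_ge0.
all: try exact: admissible_funrpos; try exact: admissible_funrneg.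
- by move=> x; case: (fg x) => E; [left|right]; rewrite /funrneg E oppr0 maxxx.
- by move=> x; case: (fg x) => E; [left|right]; rewrite /funrpos E maxxx.
Qed.

(** The sum [f + g] exceeds [c] only where [g] is positive, so cutting it at height [c] recovers [f]
    below and [g] above. *)
Lemma rho_plateau f g c : B f -> B g ->
  (forall x, 0 <= g x /\ g x <= f x /\ f x <= c) ->
  (forall x, 0 < g x -> f x = c) ->
  forall a b : R, rho (a *: f + b *: g) = a * rho f + b * rho g.
Proof.
move=> Bf Bg fgc fc a b.
(* A noncompact space has a point, and there [c] dominates a nonnegative value; this makes the cut
   at [c] fix 0. *)
have c0 : ~ compact [set: X] -> 0 <= c.
  have [->|/set0P[x _] _] := eqVneq [set: X] set0; first by have := @compact0 X.
  by have := fgc x; lra.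
have fE : f = (fun t => Num.min t c) \o (f + g).
  apply/funext => x /=; rewrite -[(f + g) x]/(f x + g x).
  have fgx := fgc x; have := fc x.
  have [gx /(_ isT) e|gx _] := ltP 0 (g x); first by rewrite e; case: leP; lra.
  by case: leP; lra.
have gE : g = (fun t => Num.max (t - c) 0) \o (f + g).
  apply/funext => x /=; rewrite -[(f + g) x]/(f x + g x).
  have fgx := fgc x; have := fc x.
  have [gx /(_ isT) e|gx _] := ltP 0 (g x); first by rewrite e; case: leP; lra.
  by case: leP; lra.
have minP := composable_comp (composable_min c0) (composable_scale X a).
have excessP := composable_comp (composable_excess c0) (composable_scale X b).
transitivity (rho ((fun t => a * Num.min t c) \o (f + g)) +
    rho ((fun t => b * Num.max (t - c) 0) \o (f + g))).
  rewrite -(rho_compD (admissibleD Bf Bg) minP excessP); congr rho.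
  apply/funext => x; congr (_ + _).
    exact: (congr1 (fun u => a * u x) fE).
  exact: (congr1 (fun u => b * u x) gE).
by rewrite -!rhoZ// [in RHS]fE [X in _ = _ + rho (_ *: X)]gE.
Qed.

Lemma singly_generated_self f : singly_generated B f f.
Proof. by move=> A. Qed.

(** Subtracting [c] makes [f] disjoint from [g], and a constant splits off from any [h] because it
    lies in the subalgebra generated by [h]. *)
Lemma rho_constant_on f g c : all_contain_constants B -> B f -> B g ->
  (forall x, g x != 0 -> f x = c) -> rho (f + g) = rho f + rho g.
Proof.
move=> constB Bf Bg fc; have Bfg := admissibleD Bf Bg.
have B1 : B (cst (- c)).
  by have [SB _ _ _ _] := singly_generated_subalgebra admB Bf; apply: SB; exact: constB.
have shift h : B h -> rho (h + cst (- c)) = rho h + rho (cst (- c)).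
  by move=> Bh; apply: (rhoB.2 h h (cst (- c)) Bh); [exact: singly_generated_self|exact: constB].
have : rho (f + cst (- c) + g) = rho (f + cst (- c)) + rho g.
  apply: rho_disjoint => // [|x]; first exact: admissibleD.
  have [|gx] := eqVneq (g x) 0; [by right|left].
  by rewrite -[LHS]/(f x - c) fc// subrr.
by rewrite addrAC !shift//; lra.
Qed.

End SignedQuasiLinear.

(** * Monotonicity of positive quasi-linear functionals *)

Section QuasiLinear.
Variables (R : realType) (X : topologicalType) (B : set (X -> R)).
Variable rho : (X -> R) -> R.
Hypothesis admB : admissible_class B.
Hypothesis rhoB : quasi_linear B rho.
Local Notation composable := (composable X).
Implicit Types (f g : X -> R) (phi psi : R -> R).
Let srhoB : signed_quasi_linear B rho := rhoB.1.

Lemma ler_rho_singly_generated h f g : B h ->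
  singly_generated B h f -> singly_generated B h g ->
  (forall x, g x <= f x) -> rho g <= rho f.
Proof.
move=> Bh Sf Sg gf; have [SB _ SZ SD _] := singly_generated_subalgebra admB Bh.
have SNg := SZ (-1) _ Sg.
have : 0 <= rho (f + (-1) *: g).
  apply: rhoB.2 => [|x]; first by apply: SB; exact: SD.
  by rewrite -[X in 0 <= X]/(f x + (-1) * g x) mulN1r subr_ge0.
rewrite (srhoB.2 h f ((-1) *: g) Bh Sf SNg) (srhoB.1 (-1) g (SB _ Sg)).
by rewrite mulN1r subr_ge0.
Qed.

Lemma ler_rho_comp f phi psi : B f -> composable phi -> composable psi ->
  (forall x, phi (f x) <= psi (f x)) -> rho (phi \o f) <= rho (psi \o f).
Proof.
move=> Bf phiP psiP le_f.
by apply: (@ler_rho_singly_generated f) => //; exact: singly_generated_comp.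
Qed.

Lemma ler_rho_plateau f g c : B f -> B g ->
  (forall x, 0 <= g x /\ g x <= f x /\ f x <= c) ->
  (forall x, 0 < g x -> f x = c) -> rho g <= rho f.
Proof.
move=> Bf Bg fgc fc; have := rho_plateau admB srhoB Bf Bg fgc fc 1 (-1).
rewrite mul1r mulN1r => rhoE; rewrite -subr_ge0 -rhoE; apply: rhoB.2 => [|x].
  have [_ _ BZ BD _] := admissible_subalgebra admB Bf.
  by apply: BD; exact: BZ.
have fgx := fgc x; rewrite -[X in 0 <= X]/(1 * f x + (-1) * g x); lra.
Qed.

(** The part of [t] between heights [k d] and [(k + 1) d]: the increment between consecutive
    truncations of [t]. *)
Definition slice (d : R) (k : nat) (t : R) := Num.min (Num.max (t - k%:R * d) 0) d.

Lemma composable_truncation (d : R) k : 0 <= d ->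
  composable (fun t => Num.min t (k%:R * d)).
Proof. by move=> d0; apply: composable_min => _; rewrite mulr_ge0. Qed.

Lemma composable_slice d k : 0 <= d -> composable (slice d k).
Proof.
move=> d0.
apply: (composable_comp (composable_excess (c := k%:R * d) _) (composable_min _))
  => // _.
by rewrite mulr_ge0.
Qed.

Lemma rho_truncationS f d k : B f -> 0 <= d ->
  rho ((fun t => Num.min t (k.+1%:R * d)) \o f) =
  rho ((fun t => Num.min t (k%:R * d)) \o f) + rho (slice d k \o f).
Proof.
move=> Bf d0.
rewrite -(rho_compD admB srhoB Bf (composable_truncation k d0) (composable_slice k d0)).
congr rho; apply/funext => x; rewrite /slice /= -natr1 mulrDl mul1r.
set t := f x; set c := _ * d.
by case: (leP t c) => ?; case: (leP t (c + d)) => ?; case: (leP (t - c) 0) => ?;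
  case: leP => ?; lra.
Qed.

(* Where [slice d k.+1 \o g] is positive, [f >= g > (k + 1) d], so the slice of [f]
   just below is at its top value [d]. *)
Lemma ler_rho_slice f g d k : B f -> B g -> 0 <= d -> (forall x, g x <= f x) ->
  rho (slice d k.+1 \o g) <= rho (slice d k \o f).
Proof.
move=> Bf Bg d0 gf; apply: (@ler_rho_plateau _ _ d).
- exact: (admissible_comp admB Bf (composable_slice k d0)).
- exact: (admissible_comp admB Bg (composable_slice k.+1 d0)).
- move=> x; have gfx := gf x; rewrite /slice /= -natr1 mulrDl mul1r.
  set c := _ * d.
  case: (leP (g x - (c + d)) 0) => gx.
    rewrite (min_l d0) le_min le_max lexx d0 orbT ge_min lexx orbT; split => //.
  rewrite [Num.max (f x - c) 0]max_l; last by lra.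
  rewrite [Num.min (f x - c) d]min_r; last by lra.
  by case: (leP (g x - (c + d)) d) => ?; split; try split; lra.
- move=> x; have gfx := gf x; rewrite /slice /= -natr1 mulrDl mul1r.
  set c := _ * d.
  case: (leP (g x - (c + d)) 0) => gx; first by rewrite (min_l d0) ltxx.
  by move=> _; rewrite max_l ?min_r//; lra.
Qed.

(** Induction on slices: each slice of [g] is paired with the slice of [f] one index lower, so the
    lowest slice of [g] remains as the error term. *)
Lemma ler_rho_truncation f g d k : B f -> B g -> 0 <= d ->
  (forall x, 0 <= g x) -> (forall x, g x <= f x) ->
  rho ((fun t => Num.min t (k.+1%:R * d)) \o g) <=
  rho ((fun t => Num.min t (k%:R * d)) \o f) +
  rho ((fun t => Num.min t d) \o g).
Proof.
move=> Bf Bg d0 g0 gf; elim: k => [|k IH].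
  rewrite mul1r lerDr; apply: rhoB.2 => [|x].
    exact: (admissible_comp admB Bf (composable_truncation 0 d0)).
  by rewrite /= mul0r le_min lexx (le_trans (g0 x)).
rewrite rho_truncationS// [in leRHS]rho_truncationS//.
have := ler_rho_slice k Bf Bg d0 gf; move: IH; lra.
Qed.

(* The inequality [min(t, e^2) <= e sqrt t] dispenses with a cutoff function equal
   to 1 on the support of [g]. *)
Lemma rho_min_small g e : B g -> 0 <= e -> (forall x, 0 <= g x) ->
  rho ((fun t => Num.min t (e ^+ 2)) \o g) <= e * rho ((@Num.sqrt R) \o g).
Proof.
move=> Bg e0 g0.
have sqrtP : composable (@Num.sqrt R).
  by split=> [|_]; [exact: sqrt_continuous|exact: sqrtr0].
rewrite -(rhoZ srhoB e (admissible_comp admB Bg sqrtP)).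
apply: (ler_rho_comp Bg _ (composable_comp sqrtP (composable_scale X e))).
  by apply: composable_min => _; exact: sqr_ge0.
move=> x /=; set s := Num.sqrt _.
have s0 : 0 <= s by exact: sqrtr_ge0.
have -> : g x = s ^+ 2 by rewrite sqr_sqrtr.
by have [es|se] := leP e s; rewrite ge_min; apply/orP; [right|left]; nra.
Qed.

(** Slices of height [e ^+ 2] leave an error [e * C] with [C] independent of [e], which can be made
    arbitrarily small. *)
Lemma ler_rho_ge0 f g : B f -> B g -> (forall x, 0 <= g x) ->
  (forall x, g x <= f x) -> rho g <= rho f.
Proof.
move=> Bf Bg g0 gf; set C := rho (@Num.sqrt R \o g).
have key e : 0 < e -> rho g <= rho f + e * C.
  move=> e0; have d0 : 0 < e ^+ 2 by rewrite exprn_gt0.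
  have [M M0 Mg] := admissible_bounded admB Bg.
  (* Enough slices to pass the bound [M], so that truncating [g] changes nothing. *)
  pose k := Num.bound (M / e ^+ 2).
  have kM : M <= k.+1%:R * e ^+ 2.
    rewrite -ler_pdivrMr// ltW// (lt_le_trans (archi_boundP _)) ?ler_nat//.
    by rewrite divr_ge0 ?ltW.
  have := ler_rho_truncation k Bf Bg (ltW d0) g0 gf.
  rewrite (_ : _ \o g = g); last first.
    apply/funext => x /=; rewrite min_l// (le_trans _ kM)// (le_trans _ (Mg x))//.
    exact: ler_norm.
  move=> /le_trans; apply; apply: lerD; last exact: (rho_min_small Bg (ltW e0) g0).
  apply: (ler_rho_comp Bf (composable_truncation k (ltW d0)) (@composable_id R X)).
  by move=> x; rewrite ge_min lexx.
(* Adding 1 keeps the divisor positive, and [e / D * C] is at most [e]. *)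
apply/ler_addgt0Pr => e e0; pose D : R := `|C| + 1.
have D0 : (0 : R) < D by rewrite ltr_wpDl.
have := key (e / D) (divr_gt0 e0 D0); move=> /le_trans; apply; rewrite lerD2l.
rewrite mulrAC ler_pdivrMr// ler_wpM2l ?(ltW e0)//.
by rewrite /D; have := ler_norm C; lra.
Qed.

(** Passing from [g] to [f] raises the positive part and lowers the negative part; both comparisons
    are between nonnegative functions. *)
Lemma ler_rho f g : B f -> B g -> (forall x, g x <= f x) -> rho g <= rho f.
Proof.
move=> Bf Bg gf.
rewrite (rho_funrposneg admB srhoB Bf) (rho_funrposneg admB srhoB Bg).
apply: lerB.
  apply: ler_rho_ge0; [exact: admissible_funrpos|exact: admissible_funrpos| |].
    by move=> x; exact: funrpos_ge0.
  by move=> x; rewrite /funrpos; have gfx := gf x; do 2!case: (leP _ 0) => ?; lra.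
apply: ler_rho_ge0; [exact: admissible_funrneg|exact: admissible_funrneg| |].
  by move=> x; exact: funrneg_ge0.
by move=> x; rewrite /funrneg; have gfx := gf x; do 2!case: (leP _ 0) => ?; lra.
Qed.

End QuasiLinear.

(** * Compactly supported functions and assembly of the properties *)

Lemma C_c_sub_admissible (R : realType) (X : topologicalType) (B : set (X -> R)) :
  admissible_class B -> @C_c X R `<=` B.
Proof.
move=> admB f Cf.
have [[cX BE]|[cX]] := admissible_cases admB; first by rewrite BE; exact: Cf.1.
(* For noncompact [X] the class [C_c] is itself admissible, so its members are bounded by the
   general lemma. *)
have CcP : admissible_class (@C_c X R).
  by split=> // _; exact: Or33.
case=> ->; last by [].
  split; first exact: Cf.1.
  have [M M0 Mf] := admissible_bounded CcP Cf.
  by exists M; split; [exact: num_real|move=> N MN x _ /=; rewrite (le_trans (Mf x))// ltW].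
split=> [|e e0]; first exact: Cf.1.
apply: subclosed_compact Cf.2 _; first exact: closed_norm_ge Cf.1.
by move=> x /= ef; apply: subset_closure; rewrite /= -normr_gt0 (lt_le_trans e0).
Qed.

Theorem lemma20 (R : realType) (X : topologicalType)
    (hlc : locally_compact [set: X]) (hH : hausdorff_space X)
    (hconn : connected [set: X])
    (B : set (X -> R)) (hB : admissible_class B)
    (rho : (X -> R) -> R) (hrho : signed_quasi_linear B rho) :
  (* (q1) *)
  (forall (f : X -> R) (n : nat) (phi : 'I_n -> R -> R),
     B f ->
     (forall i, {within closure (range f), continuous (phi i)}) ->
     (~ compact [set: X] ->
        forall i, closure (range f) 0 -> phi i 0 = 0) ->
     (forall t, closure (range f) t -> \sum_(i < n) phi i t = t) ->
     \sum_(i < n) rho (phi i \o f) = rho f) /\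
  (* (q2) *)
  ((forall f g : X -> R, B f -> B g -> f * g = 0 ->
      rho (f + g) = rho f + rho g) /\
   (forall f : X -> R, B f -> rho f = rho (f ^\+) - rho (f ^\-))) /\
  (* (q3) *)
  (forall (f g : X -> R) (c : R), B f -> B g ->
     (forall x, 0 <= g x /\ g x <= f x /\ f x <= c) ->
     (forall x, 0 < g x -> f x = c) ->
     forall a b : R, rho (a *: f + b *: g) = a * rho f + b * rho g) /\
  (* (q4); rho 1 is a real number, i.e. 1 is in the domain B of rho *)
  (all_contain_constants B -> B (cst 1) ->
     forall (f g : X -> R) (c : R), B f -> B g ->
     (forall x, g x != 0 -> f x = c) ->
     rho (f + g) = rho f + rho g) /\
  (quasi_linear B rho ->
     (* (i) *)
     (forall h f g : X -> R, B h ->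
        singly_generated B h f -> singly_generated B h g ->
        (forall x, g x <= f x) -> rho g <= rho f) /\
     (* (ii) *)
     (forall (f g : X -> R) (c : R), B f -> B g ->
        (forall x, 0 <= g x /\ g x <= f x /\ f x <= c) ->
        (forall x, 0 < g x -> f x = c) ->
        rho g <= rho f /\
        forall a b : R, rho (a *: f + b *: g) = a * rho f + b * rho g) /\
     (* (iii) *)
     (forall f g : X -> R, C_c f -> C_c g ->
        (forall x, g x <= f x) -> rho g <= rho f) /\
     (* (iv) *)
     (all_contain_constants B ->
        forall (f g : X -> R) (c : R), B f -> B g ->
        (forall x, g x != 0 -> f x = c) ->
        rho (f + g) = rho f + rho g /\
        ((forall x, g x <= f x) -> rho g <= rho f) /\
        ((forall x, f x <= g x) -> rho f <= rho g))).
Proof.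
split; [|split; [split|split; [|split]]].
- by move=> f n phi; exact: (rho_partition hB hrho).
- move=> f g Bf Bg fg0; apply: (rho_disjoint hB hrho) => // x.
  have /eqP : f x * g x = 0 by exact: (congr1 (@^~ x) fg0).
  by rewrite mulf_eq0 => /orP[] /eqP; [left|right].
- by move=> f; exact: (rho_funrposneg hB hrho).
- by move=> f g c; exact: (rho_plateau hB hrho).
- by move=> constB _ f g c; exact: (rho_constant_on hB hrho).
- move=> qB; split; [|split; [|split]].
  + by move=> h f g Bh Sf Sg; exact: (ler_rho_singly_generated hB qB Bh).
  + move=> f g c Bf Bg fgc fc; split; last exact: (rho_plateau hB hrho Bf Bg fgc).
    exact: (ler_rho_plateau hB qB Bf Bg fgc).
  (* Monotonicity holds on all of [B]; (iii) is its restriction to [C_c]. *)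
  + move=> f g Cf Cg; apply: (ler_rho hB qB); exact: C_c_sub_admissible.
  + move=> constB f g c Bf Bg fc; split; last by split; exact: (ler_rho hB qB).
    exact: (rho_constant_on hB hrho constB Bf Bg fc).
Qed.
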